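(* Let $G$ be a finite group, $N$ a normal subgroup of $G$, and $X=(G;S)$ a Cayley graph. If $X$ is $N^{\wedge}$-edge rough generating, then the graph $\overline{X}=(G;N^{\wedge}(S)^{\ast})$ is connected. Similarly, if $X$ is $N_{-}$-edge rough generating, then the graph $\underline{X}=(G;N_{-}(S))$ is connected.
   Context: Graphs are simple and undirected: a graph is a pair (vertex set, edge set) with edges being 2-element subsets of the vertex set. A non-empty graph is connected if any two vertices are linked by a path. For a finite group $G$ with identity $1$ and a subset $S\subset G$ with $1\notin S$ and $s\in S\Rightarrow s^{-1}\in S$, the Cayley graph $(G;S)$ has vertex set $G$ and edges $\{g,gs\}$ for $g\in G$, $s\in S$. For a normal subgroup $N$ of $G$ and a subset $A\subseteq G$, put $N_{-}(A)=\{x\in G: xN\subseteq A\}$, $N^{\wedge}(A)=\{x\in G: xN\cap A\neq\emptyset\}$, and $N^{\wedge}(A)^{\ast}=N^{\wedge}(A)\setminus\{1\}$. For a Cayley graph $X=(G;S)$, put $\overline{X}=(G;N^{\wedge}(S)^{\ast})$ and $\underline{X}=(G;N_{-}(S))$; these are again Cayley graphs. $X$ is called $N^{\wedge}$-edge rough generating if $N^{\wedge}(S)^{\ast}$ generates $G$, and $N_{-}$-edge rough generating if $N_{-}(S)$ generates $G$. *)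

(* Defs.v *)
From HB Require Import structures.
From mathcomp Require Import all_boot all_fingroup.

Set Implicit Arguments.
Unset Strict Implicit.
Unset Printing Implicit Defensive.

Local Open Scope group_scope.

Record sgraph (T : finType) := SGraph {
  vertices : {set T};
  edges : {set {set T}};
  edgesP : {in edges, forall e : {set T}, (e \subset vertices) && (#|e| == 2)}
}.

(* No vertex is adjacent to itself: [set x; x] has cardinal 1. *)
Definition adjacent (T : finType) (X : sgraph T) : rel T :=
  fun x y => [set x; y] \in edges X.

Definition connected_graph (T : finType) (X : sgraph T) : Prop :=
  vertices X != set0 /\
  {in vertices X &, forall x y, connect (adjacent X) x y}.

(* The Cayley graph (G; S), given by its connection set S. *)
Record cayley (gT : finGroupType) (G : {group gT}) := Cayley {
  cset : {set gT};
  cset_sub : cset \subset G;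
  cset1 : 1 \notin cset;
  csetV : {in cset, forall s, s^-1 \in cset}
}.

Section CayleyGraph.
Variables (gT : finGroupType) (G : {group gT}) (X : cayley G).

Definition cayley_edges : {set {set gT}} :=
  [set [set g; g * s] | g in G, s in cset X].

Lemma cayley_edgesP :
  {in cayley_edges, forall e : {set gT}, (e \subset G) && (#|e| == 2)}.
Proof.
move=> _ /imset2P[g s Gg Ss ->].
have Gs := subsetP (cset_sub X) s Ss.
rewrite subUset !sub1set Gg groupM //= cards2.
have -> // : g != g * s.
by apply: contraNneq (cset1 X) => /(congr1 (mulg g^-1)); rewrite mulKg mulVg => ->.
Qed.

Definition cayley_graph : sgraph gT := SGraph cayley_edgesP.

End CayleyGraph.

Section RoughSets.
Variables (gT : finGroupType) (G : {group gT}).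

Definition lower_approx (N : {group gT}) (A : {set gT}) : {set gT} :=
  [set x in G | x *: N \subset A].

Definition upper_approx (N : {group gT}) (A : {set gT}) : {set gT} :=
  [set x in G | x *: N :&: A != set0].

Variables (N : {group gT}) (nNG : N <| G) (X : cayley G).

Let S := cset X.

Lemma norm_lcosetV x : x \in G -> x^-1 *: N = (x *: N)^-1.
Proof.
move=> Gx; rewrite invg_lcoset.
by rewrite norm_rlcoset // (subsetP (normal_norm nNG)) ?groupV.
Qed.

Lemma invg_cset : S^-1 = S.
Proof.
apply/setP=> x; rewrite mem_invg; apply/idP/idP; last exact: csetV.
by move/(csetV (c:=X)); rewrite invgK.
Qed.

Lemma upper_sub : (upper_approx N S)^# \subset G.
Proof. by apply/subsetP=> x; rewrite !inE => /and3P[]. Qed.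

Lemma upper1 : 1 \notin (upper_approx N S)^#.
Proof. by rewrite !inE eqxx. Qed.

Lemma upperV : {in (upper_approx N S)^#, forall s, s^-1 \in (upper_approx N S)^#}.
Proof.
move=> x; rewrite !inE => /and3P[x1 Gx xN].
rewrite invg_eq1 x1 groupV Gx norm_lcosetV //= -invg_cset -invIg.
by case/set0Pn: xN => y yN; apply/set0Pn; exists y^-1; rewrite mem_invg invgK.
Qed.

Lemma lower_sub : lower_approx N S \subset G.
Proof. by apply/subsetP=> x; rewrite inE => /andP[]. Qed.

Lemma lower1 : 1 \notin lower_approx N S.
Proof.
rewrite inE group1 /= lcoset1.
by apply/subsetPn; exists 1; rewrite ?group1 ?cset1.
Qed.

Lemma lowerV : {in lower_approx N S, forall s, s^-1 \in lower_approx N S}.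
Proof.
move=> x; rewrite !inE => /andP[Gx xN].
by rewrite groupV Gx norm_lcosetV // -invg_cset invSg.
Qed.

Definition upper_cayley : cayley G := Cayley upper_sub upper1 upperV.

Definition lower_cayley : cayley G := Cayley lower_sub lower1 lowerV.

End RoughSets.

Definition upper_edge_rough_generating (gT : finGroupType) (G N : {group gT})
  (X : cayley G) : Prop := <<(upper_approx G N (cset X))^#>> = G.

Definition lower_edge_rough_generating (gT : finGroupType) (G N : {group gT})
  (X : cayley G) : Prop := <<lower_approx G N (cset X)>> = G.

(* Main.v *)
Require Import Defs.
From mathcomp Require Import all_boot all_fingroup.

Local Open Scope group_scope.

(** A path from [x] to [y] in a Cayley graph spells [x^-1 * y] as a word in the connection set, so
    the graph is connected once that set generates [G] ([connected_cayley_graph]). Both rough graphs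
    are Cayley graphs on [G], and rough generation says exactly that their connection sets
    generate. *)

Lemma adjacent_cayley_mulr (gT : finGroupType) (G : {group gT}) (X : cayley G)
  (g s : gT) :
  g \in G -> s \in cset X -> adjacent (cayley_graph X) g (g * s).
Proof.
by move=> Gg Ss; rewrite /adjacent /= /cayley_edges; apply/imset2P; exists g s.
Qed.

(** Write [z] as a product of elements of [cset X], as [gen_prodgP] allows; each factor is then one
    edge of a walk starting at [x]. *)
Lemma connect_cayley_mulr (gT : finGroupType) (G : {group gT}) (X : cayley G)
  (x z : gT) :
  x \in G -> z \in <<cset X>> -> connect (adjacent (cayley_graph X)) x (x * z).
Proof.
move=> Gx /gen_prodgP[n [c Sc ->]].
have Gc i : c i \in G by apply: subsetP (cset_sub X) _ (Sc i).
elim: n c Sc Gc => [|n IHn] c Sc Gc; first by rewrite big_ord0 mulg1.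
(* Edges multiply on the right, so the last factor is split off as the final edge and [x] stays
   fixed in the induction. *)
rewrite big_ord_recr mulgA.
apply: connect_trans (IHn (fun i => c (widen_ord (leqnSn n) i)) _ _) _ => //.
by apply/connect1/adjacent_cayley_mulr; rewrite // groupM // group_prod.
Qed.

Lemma connected_cayley_graph (gT : finGroupType) (G : {group gT})
  (X : cayley G) :
  <<cset X>> = G -> connected_graph (cayley_graph X).
Proof.
move=> genX; split=> [|x y /= Gx Gy].
  by apply/set0Pn; exists 1; apply: group1.
rewrite -(mulKVg x y); apply: connect_cayley_mulr => //.
by rewrite genX groupM ?groupV.
Qed.

Theorem theorem4p7 (gT : finGroupType) (G N : {group gT}) (nNG : N <| G)
  (X : cayley G) :
  (upper_edge_rough_generating N X ->
     connected_graph (cayley_graph (upper_cayley nNG X))) /\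
  (lower_edge_rough_generating N X ->
     connected_graph (cayley_graph (lower_cayley nNG X))).
(* [genX] unfolds to [<<cset _>> = G] for the rough Cayley graph. *)
Proof. by split=> genX; apply: connected_cayley_graph. Qed.
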